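(* Let $l>0$ be real, let $M,N$ be nonnegative integers with $M<N$, and let $P=\sum_{k=0}^N a_kX^k$ be a real polynomial of degree $N$. Put $p=\lfloor M/2\rfloor$, $p_1=\lfloor (M-1)/2\rfloor$, $q=\lfloor N/2\rfloor$, $q_1=\lfloor (N-1)/2\rfloor$. For integers $0\le m\le p$, $p+1\le n\le q$ let $$v_{2m,2n}=\frac{(-1)^{p-m}\,l^{2(n-m)}\,(2n)!}{2^{n-m}(n-m)!\,(p-m)!\,(2m)!}\ \prod_{r=n-p}^{n-m-1}r\ \prod_{r=p+m+1}^{p+n}\frac{1}{2r+1},$$ and for integers $0\le m\le p_1$, $p_1+1\le n\le q_1$ let $$v_{2m+1,2n+1}=\frac{(-1)^{p-m}\,l^{2(n-m)}\,(2n+1)!}{2^{n-m}(n-m)!\,(p-m)!\,(2m+1)!}\ \prod_{r=n-p}^{n-m-1}r\ \prod_{r=p+m+2}^{p+n+1}\frac{1}{2r+1}.$$ Then the minimizer $(b_0,\dots,b_M)\in\mathbb{R}^{M+1}$ of $$J_P(b_0,\dots,b_M)=\frac{1}{2l}\int_{-l}^{l}\Big(\sum_{k=0}^{M}b_kx^k-P(x)\Big)^2dx$$ over $\mathbb{R}^{M+1}$ is given by $$b_{2m}=a_{2m}+\sum_{n=p+1}^{q}v_{2m,2n}\,a_{2n}\quad(0\le m\le p),\qquad b_{2m+1}=a_{2m+1}+\sum_{n=p_1+1}^{q_1}v_{2m+1,2n+1}\,a_{2n+1}\quad(0\le m\le p_1).$$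
   Context: Empty products equal $1$, empty sums equal $0$, and empty index ranges impose no condition.
   Formalization: In the formula for v_{2m+1,2n+1}, every p is read as p_1 = floor((M-1)/2); with p = floor(M/2) the claim fails for even M > 0 (M=2, N=3, P=X^3 would give b_1 = 0 instead of 3l^2/5). For odd M nothing changes. *)

(* Defs.v *)
From HB Require Import structures.
From mathcomp Require Import all_boot all_order all_algebra.
From mathcomp Require Import all_classical all_reals all_analysis.

Set Implicit Arguments.
Unset Strict Implicit.
Unset Printing Implicit Defensive.

Import Order.TTheory GRing.Theory Num.Theory.
Import numFieldNormedType.Exports.

Local Open Scope classical_set_scope.
Local Open Scope ring_scope.

(* J_P(b_0,...,b_M), where the row vector b lists b_0,...,b_M. *)
Definition J (R : realType) (l : R) (M : nat) (P : {poly R})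
    (b : 'rV[R]_M.+1) : R :=
  (2 * l)^-1 *
  \int[lebesgue_measure]_(x in `[- l, l])
    ((\sum_(k < M.+1) b 0 k * x ^+ k - P.[x]) ^+ 2).

Definition is_minimizer (R : realType) (l : R) (M : nat) (P : {poly R})
    (b : 'rV[R]_M.+1) : Prop :=
  forall c : 'rV[R]_M.+1, J l P b <= J l P c.

(* v_{2m,2n}, meaningful for m <= p < n: every subtraction of naturals below
   is then a true one.  A product over r = i, ..., j is written with the
   half-open range i <= r < j + 1. *)
Definition v_even (R : realType) (l : R) (p m n : nat) : R :=
  ((-1) ^+ (p - m) * l ^+ (2 * (n - m)) * ((2 * n)`!)%:R) /
  (2 ^+ (n - m) * ((n - m)`!)%:R * ((p - m)`!)%:R * ((2 * m)`!)%:R) *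
  (\prod_(n - p <= r < n - m) r%:R) *
  \prod_(p + m + 1 <= r < p + n + 1) (1 / (2 * r + 1)%:R).

(* v_{2m+1,2n+1}, meaningful for m <= p < n.  Here p stands for
   floor((M - 1) / 2), the largest m with 2m + 1 <= M; with floor(M / 2)
   instead, the formula would be wrong for every even M > 0: the best
   approximation of X^3 on [-l, l] in degree at most M = 2 is
   (3 l^2 / 5) X, but that reading makes v_{1,3} vanish. *)
Definition v_odd (R : realType) (l : R) (p m n : nat) : R :=
  ((-1) ^+ (p - m) * l ^+ (2 * (n - m)) * ((2 * n + 1)`!)%:R) /
  (2 ^+ (n - m) * ((n - m)`!)%:R * ((p - m)`!)%:R * ((2 * m + 1)`!)%:R) *
  (\prod_(n - p <= r < n - m) r%:R) *
  \prod_(p + m + 2 <= r < p + n + 2) (1 / (2 * r + 1)%:R).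

(* Main.v *)
Require Import Defs.
From HB Require Import structures.
From mathcomp Require Import all_boot all_order all_algebra.
From mathcomp Require Import all_classical all_reals all_analysis.
From mathcomp Require Import ring lra zify.
Import Order.TTheory GRing.Theory Num.Theory.
Import numFieldNormedType.Exports.
Local Open Scope ring_scope.

Set Implicit Arguments.
Unset Strict Implicit.
Unset Printing Implicit Defensive.

(** Minimizing [J] means projecting [P] orthogonally, in L2 of [[-l, l]], on
the polynomials of degree at most [M].  By Pythagoras a polynomial [B] of that
degree is the only minimizer as soon as [B - P] is orthogonal to ['X^j] for
all [j <= M] ([minimizer_orthogonal]).  By linearity it suffices to project the
monomials ['X^i] with [M < i].  The interval is symmetric, so only monomials
of the same parity interact; for ['X^(2n+e)], with [e] the parity, the
condition on the coefficients [u m] of ['X^(2m+e)], [m <= p], is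
  1 / (2(n+s)+c) = sum_(m <= p) w m / (2(m+s)+c)   for all [s <= p],
where [c = 2e+1] and [u m = l^(2(n-m)) * w m].

This system, with a Cauchy matrix, is solved by Lagrange interpolation: for
each [s] the polynomial [g_s = prod_(i <= p, i <> s) (2(X+i)+c)] has degree
[p], so its value at [n] is the combination of its values at [0, ..., p] with
the Lagrange weights.  Dividing by [prod_(i <= p) (2(n+i)+c)] gives the
equation of index [s], with weights [w m] that do not depend on [s]
([weight_sum]).  Rewriting those products with factorials turns
[l^(2(n-m)) * w m] into the closed forms [v_even] and [v_odd] ([v_coefE]). *)

(** * Integration of polynomials over a symmetric interval *)

(** The coefficient of index 0 is [Q`_0 / 0 = 0], so this is the primitive that
vanishes at 0. *)
Definition primitive (R : realType) (Q : {poly R}) : {poly R} :=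
  \poly_(i < (size Q).+1) (Q`_i.-1 / i%:R).

Lemma coef_primitive (R : realType) (Q : {poly R}) (i : nat) :
  (primitive Q)`_i = Q`_i.-1 / i%:R.
Proof.
rewrite coef_poly; case: ltnP => // lt_Q_i.
by rewrite nth_default ?mul0r//; case: i lt_Q_i.
Qed.

Lemma primitive_deriv (R : realType) (Q : {poly R}) : (primitive Q)^`() = Q.
Proof.
apply/polyP => i; rewrite coef_deriv coef_primitive /=.
by rewrite -(mulr_natr (_ / _)) divfK// pnatr_eq0.
Qed.

Lemma primitive_linear (R : realType) (a : R) (Q1 Q2 : {poly R}) :
  primitive (a *: Q1 + Q2) = a *: primitive Q1 + primitive Q2.
Proof.
apply/polyP => i.
by rewrite !(coefD, coefZ, coef_primitive) mulrDl mulrA.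
Qed.

Lemma primitiveXn (R : realType) (n : nat) :
  primitive 'X^n = n.+1%:R^-1 *: 'X^(n.+1) :> {poly R}.
Proof.
apply/polyP => -[|i]; rewrite coef_primitive coefZ !coefXn.
  by rewrite invr0 !mulr0.
by rewrite eqSS /= mulrC; case: eqP => [->|]; rewrite ?mulr0.
Qed.

(** The integral over [[-l, l]], in an algebraic form that is linear in [Q]
for every [l]; [Rintegral_poly] identifies it with the Lebesgue integral. *)
Definition sym_integral (R : realType) (l : R) (Q : {poly R}) : R :=
  (primitive Q).[l] - (primitive Q).[- l].

Lemma sym_integral_scalar (R : realType) (l : R) : scalar (sym_integral l).
Proof.
move=> a Q1 Q2; rewrite /sym_integral primitive_linear !(hornerD, hornerZ).
by rewrite opprD addrACA -mulrBr.
Qed.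

HB.instance Definition _ (R : realType) (l : R) :=
  GRing.isLinear.Build R {poly R} R *%R (sym_integral l)
    (sym_integral_scalar l).

Lemma sym_integralXn (R : realType) (l : R) (n : nat) :
  sym_integral l 'X^n = if odd n then 0 else 2 * l ^+ n.+1 / n.+1%:R.
Proof.
rewrite /sym_integral primitiveXn !hornerE exprNn -signr_odd /=.
by case: (odd n); rewrite /= ?expr0 ?expr1; ring.
Qed.

Lemma Rintegral_poly (R : realType) (l : R) (Q : {poly R}) : 0 < l ->
  \int[lebesgue_measure]_(x in `[- l, l]%classic) Q.[x] = sym_integral l Q.
Proof.
move=> l_gt0.
rewrite /Rintegral (@continuous_FTC2 _ _ (horner (primitive Q))) //.
- by rewrite gtrN.
- by apply: continuous_subspaceT; exact: continuous_horner.
- split => [x _||].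
  + exact: derivable_horner.
  + by apply: cvg_at_right_filter; exact: continuous_horner.
  + by apply: cvg_at_left_filter; exact: continuous_horner.
- by move=> x _; rewrite -derivE primitive_deriv.
Qed.

Lemma primitive_sqr_homo (R : realType) (Q : {poly R}) (x y : R) :
  x <= y -> (primitive (Q ^+ 2)).[x] <= (primitive (Q ^+ 2)).[y].
Proof.
move=> le_xy; apply: (@ger0_derive1_ndecr R (horner (primitive (Q ^+ 2))) x y) => //.
- by move=> z _; rewrite -derivE primitive_deriv horner_exp sqr_ge0.
- by apply: continuous_subspaceT; exact: continuous_horner.
Qed.

Lemma sym_integral_sqr_ge0 (R : realType) (l : R) (Q : {poly R}) :
  0 < l -> 0 <= sym_integral l (Q ^+ 2).
Proof.
by move=> l_gt0; rewrite subr_ge0 primitive_sqr_homo// ge0_cp// ltW.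
Qed.

(** The primitive [A] of [Q ^+ 2] is nondecreasing and takes the same value at
both ends, so it is constant on the interval; a polynomial constant at
infinitely many points is constant, whence [Q ^+ 2 = A^`() = 0]. *)
Lemma sym_integral_sqr_eq0 (R : realType) (l : R) (Q : {poly R}) :
  0 < l -> sym_integral l (Q ^+ 2) = 0 -> Q = 0.
Proof.
move=> l_gt0 /eqP; rewrite subr_eq0 => /eqP eqA.
set A := primitive (Q ^+ 2) in eqA.
have cstA x : 0 <= x -> x <= l -> A.[x] = A.[l].
  move=> x_ge0 le_xl; apply/le_anti; rewrite primitive_sqr_homo//= eqA.
  by rewrite primitive_sqr_homo// (le_trans _ x_ge0)// oppr_le0 ltW.
have /(congr1 (@deriv R)) : A - A.[l]%:P = 0.
  (* too many points of ]0, l] for the roots of a nonzero polynomial of the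
     size of A - A.[l]%:P *)
  pose rs := [seq l / i.+1%:R | i <- iota 0 (size (A - A.[l]%:P))].
  apply: (@roots_geq_poly_eq0 _ _ rs).
  - apply/allP => _ /mapP[i _ ->]; rewrite rootE !hornerE subr_eq0 cstA//.
      by rewrite divr_ge0// ltW.
    by rewrite ler_pdivrMr// ler_peMr ?ler1n// ltW.
  - rewrite map_inj_uniq ?iota_uniq// => i j /(mulfI (lt0r_neq0 l_gt0)).
    by move/invr_inj/eqP; rewrite eqr_nat => /eqP[].
  - by rewrite size_map size_iota.
rewrite derivB derivC subr0 deriv0 primitive_deriv => /eqP.
by rewrite sqrf_eq0 => /eqP.
Qed.

(** * Splitting sums by parity *)

Lemma sum_parity (V : nmodType) (F : nat -> V) (e : bool) (a b : nat) :
  (a <= b)%N ->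
  \sum_(a <= k < b | odd k == e) F k =
  \sum_(uphalf (a - e) <= m < uphalf (b - e)) F (2 * m + e)%N.
Proof.
elim: b => [|b IHb]; first by rewrite leqn0 => /eqP->; rewrite !big_geq.
rewrite leq_eqVlt ltnS => /predU1P[->|le_ab]; first by rewrite !big_geq.
rewrite big_mkcond big_nat_recr//= -big_mkcond/= IHb//.
have [odd_b|odd_b] := eqVneq.
  have -> : uphalf (b.+1 - e) = (uphalf (b - e)).+1 by lia.
  rewrite [RHS]big_nat_recr/=; last by lia.
  by congr (_ + F _); lia.
rewrite addr0; congr bigop; congr index_iota; lia.
Qed.

(** * Odd double factorials *)

(** The double factorial [(2n - 1)!!]. *)
Definition odd_prod (R : realFieldType) (n : nat) : R :=
  \prod_(0 <= i < n) (2 * i + 1)%:R.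

Lemma odd_prod_neq0 (R : realFieldType) (n : nat) : odd_prod R n != 0.
Proof.
by rewrite prodf_seq_neq0; apply/allP => i _; rewrite pnatr_eq0 addn1.
Qed.

Lemma prod_odd (R : realFieldType) (a b : nat) : (a <= b)%N ->
  \prod_(a <= r < b) (2 * r + 1)%:R = odd_prod R b / odd_prod R a :> R.
Proof.
move=> le_ab.
have -> : odd_prod R b =
    odd_prod R a * \prod_(a <= r < b) (2 * r + 1)%:R.
  by rewrite /odd_prod (big_cat_nat (n:=a)).
by rewrite [RHS]mulrC mulKf// odd_prod_neq0.
Qed.

Lemma fact_double (R : realFieldType) (e : bool) (n : nat) :
  ((2 * n + e)`!)%:R = 2 ^+ n * (n`!)%:R * odd_prod R (n + e) :> R.
Proof.
have double k : ((2 * k)`!)%:R = 2 ^+ k * (k`!)%:R * odd_prod R k :> R.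
  elim: k => [|k IHk]; first by rewrite /odd_prod big_nil expr0 !mulr1.
  have -> : (2 * k.+1 = (2 * k).+2)%N by lia.
  rewrite !factS !natrM IHk /odd_prod big_nat_recr//= exprS.
  by rewrite -!natr1 natrD natrM; ring.
case: e; rewrite ?(addn0, addn1)// factS natrM double.
by rewrite /odd_prod big_nat_recr//= -addn1; ring.
Qed.

(** * Lagrange interpolation at the first integers *)

(** The value at [n] of the Lagrange basis polynomial of the node [m] among
[0, ..., p]. *)
Definition lagrange_weight (R : realFieldType) (p m n : nat) : R :=
  \prod_(i < p.+1 | i != m :> nat) ((n%:R - i%:R) / (m%:R - i%:R)).

(** The three products that make up a Lagrange weight at the nodes
[0, ..., p]: the nodes below [m], for numerator and denominator alike, then
those above [m], separately since [n - i > 0 > m - i] there. *)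
Lemma prod_sub_lo (R : realFieldType) (m n : nat) : (m <= n)%N ->
  \prod_(0 <= i < m) (n%:R - i%:R) = (n`!)%:R / ((n - m)`!)%:R :> R.
Proof.
elim: m => [|m IHm] le_mn.
  by rewrite big_nil subn0 divff// pnatr_eq0 -lt0n fact_gt0.
rewrite big_nat_recr//= IHm ?(ltnW le_mn)// -natrB ?(ltnW le_mn)//.
rewrite -(subnSK le_mn) factS natrM invfM.
by rewrite mulrCA mulrC mulVKf ?pnatr_eq0.
Qed.

Lemma prod_sub_hi (R : realFieldType) (m n p : nat) :
  (m <= p)%N -> (p < n)%N ->
  \prod_(m.+1 <= i < p.+1) (n%:R - i%:R) = \prod_(n - p <= r < n - m) r%:R :> R.
Proof.
move=> /subnKC <-; elim: (p - m)%N => [|d IHd] lt_n.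
  by rewrite addn0 !big_geq.
rewrite addnS big_nat_recr/=; last by rewrite ltnS leq_addr.
rewrite IHd; last by lia.
rewrite [RHS]big_ltn; last by lia.
rewrite mulrC -natrB; last by lia.
by congr (_ * bigop _ (index_iota _ _) _); lia.
Qed.

Lemma prod_sub_hi_neg (R : realFieldType) (m p : nat) : (m <= p)%N ->
  \prod_(m.+1 <= i < p.+1) (m%:R - i%:R) =
  (-1) ^+ (p - m) * ((p - m)`!)%:R :> R.
Proof.
move=> le_mp; rewrite -{1}(subnKC le_mp); elim: (p - m)%N => [|d IHd].
  by rewrite addn0 big_geq// mulr1.
rewrite addnS big_nat_recr/=; last by rewrite ltnS leq_addr.
rewrite IHd exprS factS natrM -addnS natrD; ring.
Qed.

Lemma lagrange_weightE (R : realFieldType) (p m n : nat) :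
  (m <= p)%N -> (p < n)%N ->
  lagrange_weight R p m n =
  (-1) ^+ (p - m) * (n`!)%:R / ((n - m)`!)%:R / (m`!)%:R / ((p - m)`!)%:R *
  \prod_(n - p <= r < n - m) r%:R.
Proof.
move=> le_mp lt_pn; have le_mn : (m <= n)%N by lia.
have -> : lagrange_weight R p m n =
    (\prod_(0 <= i < m) (n%:R - i%:R) *
     \prod_(m.+1 <= i < p.+1) (n%:R - i%:R)) /
    (\prod_(0 <= i < m) (m%:R - i%:R) *
     \prod_(m.+1 <= i < p.+1) (m%:R - i%:R)).
  have split (F : nat -> R) : \prod_(i < p.+1 | i != m :> nat) F i =
      \prod_(0 <= i < m) F i * \prod_(m.+1 <= i < p.+1) F i.
    rewrite -(big_mkord (fun i => i != m) F) (big_cat_nat (n:=m)) ?leq0n//=.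
      rewrite (big_ltn_cond (m:=m))// eqxx /=; congr (_ * _).
        by rewrite big_nat_cond [RHS]big_nat_cond; apply: eq_bigl => i; lia.
      by rewrite big_nat_cond [RHS]big_nat_cond; apply: eq_bigl => i; lia.
    by lia.
  rewrite /lagrange_weight prodf_div.
  by rewrite (split (fun i => n%:R - i%:R)) (split (fun i => m%:R - i%:R)).
rewrite !prod_sub_lo// prod_sub_hi// prod_sub_hi_neg// subnn fact0.
have nz k : (k`!)%:R != 0 :> R by rewrite pnatr_eq0 -lt0n fact_gt0.
(* the sign is its own inverse *)
rewrite -[in LHS](invrK ((-1) ^+ (p - m))) -exprVn invrN1.
field.
by rewrite !nz signr_eq0.
Qed.

(** The solution of the Cauchy system of matrix [1 / (2 (m + s) + c)]; the first
product is the ratio of the values at [m] and [n] of the polynomial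
[prod_(i <= p) (2 (X + i) + c)]. *)
Definition weight (R : realFieldType) (c p m n : nat) : R :=
  (\prod_(i < p.+1) ((2 * (m + i) + c)%:R / (2 * (n + i) + c)%:R)) *
  lagrange_weight R p m n.

(** Lagrange interpolation at [0, ..., p] of the polynomial
[prod_(i <= p, i <> s) (2 (X + i) + c)], evaluated at [n]. *)
Lemma weight_sum (R : realFieldType) (c p n s : nat) :
  (0 < c)%N -> (s <= p)%N ->
  \sum_(m < p.+1) weight R c p m n / (2 * (m + s) + c)%:R =
  (2 * (n + s) + c)%:R^-1.
Proof.
move=> c_gt0 le_sp.
have nz k : (2 * k + c)%:R != 0 :> R by rewrite pnatr_eq0; lia.
pose s' := Ordinal (le_sp : (s < p.+1)%N).
pose g : {poly R} := \prod_(i < p.+1 | i != s') (2 *: 'X + (2 * i + c)%:R%:P).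
have gE k : g.[k%:R] =
    \prod_(i < p.+1) (2 * (k + i) + c)%:R / (2 * (k + s) + c)%:R.
  rewrite horner_prod [in RHS](bigD1 s')//= mulrC mulKf//.
  by apply: eq_bigr => i _; rewrite !hornerE !(natrD, natrM); ring.
have size_g : (size g <= p.+1)%N.
  apply: (leq_trans (size_prod_leq _ _)).
  have card_s : #|[pred i | i != s']| = p by rewrite cardC1 card_ord.
  rewrite card_s leq_subLR addnS ltnS addnn -muln2.
  rewrite -[X in (X * 2)%N]card_s -sum_nat_const leq_sum// => i _.
  apply: (leq_trans (size_polyD _ _)); rewrite geq_max size_polyC.
  rewrite (leq_trans (size_scale_leq _ _)) ?size_polyX//.
  by case: eqP.
have natr_injR : injective (fun k : nat => k%:R : R).
  by move=> i j /eqP; rewrite eqr_nat => /eqP.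
have := congr1 (horner^~ n%:R) (lagrange_gen (ltn0Sn p) natr_injR size_g).
rewrite horner_sum /= gE => H.
have Dnz : \prod_(i < p.+1) (2 * (n + i) + c)%:R != 0 :> R.
  by apply/prodf_neq0 => i _.
apply: (mulfI Dnz); rewrite H mulr_sumr; apply: eq_bigr => m _.
rewrite hornerM hornerC gE lagrangeE// hornerM hornerC !horner_prod.
rewrite /weight prodf_div.
have -> : \prod_(j < p.+1 | j != m) ('X - j%:R%:P : {poly R}).[m%:R] =
   \prod_(i < p.+1 | i != m :> nat) (m%:R - i%:R).
  by apply: eq_bigr => i _; rewrite !hornerE.
have -> : \prod_(j < p.+1 | j != m) ('X - j%:R%:P : {poly R}).[n%:R] =
   \prod_(i < p.+1 | i != m :> nat) (n%:R - i%:R).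
  by apply: eq_bigr => i _; rewrite !hornerE.
rewrite /lagrange_weight prodf_div.
field.
rewrite Dnz -natrD -natrM -natrD nz !andbT.
by apply/prodf_neq0 => i ne_im; rewrite subr_eq0 eqr_nat eq_sym.
Qed.

(** * The closed form of the weights *)

Definition v_coef (R : realType) (l : R) (e : bool) (p m n : nat) : R :=
  if e then v_odd l p m n else v_even l p m n.

(** Both sides are reduced to factorials, powers of 2 and odd double
factorials, by [(2n+e)! = 2^n n! (2(n+e)-1)!!] and by reading every product of
consecutive odd numbers as a quotient of odd double factorials. *)
Lemma v_coefE (R : realType) (l : R) (e : bool) (p m n : nat) :
  (m <= p)%N -> (p < n)%N ->
  v_coef l e p m n = l ^+ (2 * (n - m)) * weight R (2 * e + 1) p m n.
Proof.
move=> le_mp lt_pn.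
(* the two definitions are the cases e = 0 and e = 1 of a single formula *)
have -> : v_coef l e p m n =
    ((-1) ^+ (p - m) * l ^+ (2 * (n - m)) * ((2 * n + e)`!)%:R) /
    (2 ^+ (n - m) * ((n - m)`!)%:R * ((p - m)`!)%:R * ((2 * m + e)`!)%:R) *
    (\prod_(n - p <= r < n - m) r%:R) *
    \prod_(p + m + e + 1 <= r < p + n + e + 1) (1 / (2 * r + 1)%:R).
  by case: e; rewrite /= ?addn0 -?[(_ + true + 1)%N]addnA.
rewrite /weight lagrange_weightE// !fact_double.
have -> : \prod_(p + m + e + 1 <= r < p + n + e + 1) (1 / (2 * r + 1)%:R) =
    odd_prod R (p + m + e + 1) / odd_prod R (p + n + e + 1).
  rewrite -[RHS]invf_div -prod_odd; last by lia.
  by rewrite -prodfV; apply: eq_bigr => i _; rewrite div1r.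
have shift k : \prod_(i < p.+1) (2 * (k + i) + (2 * e + 1))%:R =
    odd_prod R (p + k + e + 1) / odd_prod R (k + e).
  rewrite -prod_odd; last by lia.
  rewrite -(big_mkord predT (fun i => (2 * (k + i) + (2 * e + 1))%:R)).
  rewrite -{1}[(k + e)%N]add0n.
  rewrite (_ : (p + k + e + 1 = p.+1 + (k + e))%N) ?big_addn; last by lia.
  rewrite addnK; apply: eq_bigr => i _; congr (_%:R); lia.
rewrite prodf_div !shift.
have nz k : (k`!)%:R != 0 :> R by rewrite pnatr_eq0 -lt0n fact_gt0.
have nzo := odd_prod_neq0 R.
have -> : (2 : R) ^+ n = 2 ^+ (n - m) * 2 ^+ m by rewrite -exprD subnK//; lia.
field.
by rewrite !nz !nzo !expf_neq0 ?pnatr_eq0.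
Qed.

(** * Projection of the monomials *)

(** The coefficient of ['X^k] in the projection of ['X^i] on the polynomials of
degree at most [M]; [(M - e)./2] is the largest [m] with [2m + e <= M]. *)
Definition proj_coef (R : realType) (l : R) (M k i : nat) : R :=
  if odd k == odd i then v_coef l (odd k) ((M - odd k)./2) k./2 i./2 else 0.

(** That ['X^i] minus its projection is orthogonal to ['X^j].  If [i] and [j]
have different parities, the right-hand side and every integral with a nonzero
coefficient vanish; otherwise the identity is [weight_sum] multiplied by [2 l^(i+j+1)]. *)
Lemma proj_coef_moment (R : realType) (l : R) (M i j : nat) :
  (M < i)%N -> (j <= M)%N ->
  \sum_(0 <= k < M.+1) proj_coef l M k i * sym_integral l 'X^(k + j) =
  sym_integral l 'X^(i + j).
Proof.
move=> lt_Mi le_jM.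
rewrite [RHS]sym_integralXn oddD.
have [eq_ij|ne_ij] := eqVneq (odd i) (odd j); last first.
  rewrite addbC -negb_eqb eq_sym ne_ij.
  rewrite big1// => k _; rewrite /proj_coef sym_integralXn oddD.
  case: eqP => [->|]; rewrite ?mul0r//.
  by rewrite addbC -negb_eqb eq_sym ne_ij mulr0.
rewrite eq_ij addbb; set e := odd j in eq_ij *.
set p := (M - e)./2; set n := i./2; set s := j./2.
have iE : i = (2 * n + e)%N by rewrite /n; lia.
have jE : j = (2 * s + e)%N by rewrite /s /e; lia.
have le_sp : (s <= p)%N by rewrite /s /p /e; lia.
have lt_pn : (p < n)%N by rewrite /p /n; lia.
rewrite (eq_bigr (fun k => if odd k == e then
  v_coef l e p k./2 n * sym_integral l 'X^(k + j) else 0)); last first.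
  by move=> k _; rewrite /proj_coef eq_ij; case: eqP => [->|]; rewrite ?mul0r.
rewrite -big_mkcond sum_parity//.
have -> : uphalf (M.+1 - e) = p.+1 by rewrite /p /e; lia.
rewrite sub0n big_mkord.
have c_gt0 : (0 < 2 * e + 1)%N by rewrite addn1.
have term (m : 'I_p.+1) :
  v_coef l e p (2 * m + e)./2 n * sym_integral l 'X^(2 * m + e + j) =
  2 * l ^+ (i + j).+1 *
  (weight R (2 * e + 1) p m n / (2 * (m + s) + (2 * e + 1))%:R).
  have le_mp : (m <= p)%N by rewrite -ltnS.
  have -> : (2 * m + e)./2 = m by lia.
  rewrite sym_integralXn.
  have -> : odd (2 * m + e + j) = false by lia.
  rewrite v_coefE//.
  have -> : (i + j).+1 = (2 * (n - m) + (2 * m + e + j).+1)%N by lia.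
  have -> : (2 * m + e + j).+1 = (2 * (m + s) + (2 * e + 1))%N by lia.
  set d := (2 * (m + s) + _)%N; rewrite (exprD _ _ d).
  ring.
rewrite (eq_bigr _ (fun m _ => term m)) -mulr_sumr weight_sum//.
by congr (_ * _%:R^-1); lia.
Qed.

(** * Orthogonality and minimality *)

Lemma J_sym_integral (R : realType) (l : R) (M : nat) (P : {poly R})
    (b : 'rV[R]_M.+1) : 0 < l ->
  J l P b = (2 * l)^-1 * sym_integral l ((rVpoly b - P) ^+ 2).
Proof.
move=> l_gt0; rewrite -Rintegral_poly// /J; congr (_ * _).
apply: eq_Rintegral => x _; rewrite !hornerE horner_poly; congr ((_ - _) ^+ 2).
by apply: eq_bigr => k _; rewrite valK.
Qed.

(** Pythagoras: [J c] exceeds [J b] by the mean of the square of the polynomial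
of [c - b], which is positive unless [c = b]. *)
Lemma minimizer_orthogonal (R : realType) (l : R) (M : nat) (P : {poly R})
    (b : 'rV[R]_M.+1) : 0 < l ->
  (forall j, (j <= M)%N -> sym_integral l ((rVpoly b - P) * 'X^j) = 0) ->
  unique (@is_minimizer R l M P) b.
Proof.
move=> l_gt0 orth.
have orth_poly (c : 'rV[R]_M.+1) :
    sym_integral l ((rVpoly b - P) * rVpoly c) = 0.
  rewrite [rVpoly c]poly_def mulr_sumr linear_sum big1// => k _ /=.
  by rewrite -scalerAr linearZ/= orth ?mulr0// -ltnS.
have pythagoras c : J l P c =
    J l P b + (2 * l)^-1 * sym_integral l (rVpoly (c - b) ^+ 2).
  rewrite !J_sym_integral// -mulrDr; congr (_ * _).
  have -> : rVpoly c - P = (rVpoly b - P) + rVpoly (c - b).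
    by rewrite linearB/=; ring.
  rewrite sqrrD mulr2n; move: (orth_poly (c - b)); set d := rVpoly (c - b).
  by move=> orth_d; rewrite !linearD/= orth_d !addr0.
have l2_gt0 : 0 < (2 * l)^-1 by rewrite invr_gt0 mulr_gt0.
split=> [c|c min_c].
  by rewrite (pythagoras c) lerDl mulr_ge0 ?sym_integral_sqr_ge0// ltW.
have := min_c b; rewrite (pythagoras c) gerDl pmulr_rle0// => le0.
have /(sym_integral_sqr_eq0 l_gt0) : sym_integral l (rVpoly (c - b) ^+ 2) = 0.
  by apply/le_anti; rewrite le0 sym_integral_sqr_ge0.
move/(congr1 (@poly_rV R M.+1)); rewrite rVpolyK linear0 => /eqP.
by rewrite subr_eq0 => /eqP.
Qed.

(** * The minimizer *)

Definition best_coef (R : realType) (l : R) (M N : nat) (P : {poly R})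
    (k : nat) : R :=
  P`_k + \sum_(M.+1 <= i < N.+1) proj_coef l M k i * P`_i.

Lemma best_coef_orthogonal (R : realType) (l : R) (M N j : nat)
    (P : {poly R}) : (M <= N)%N -> (j <= M)%N -> size P = N.+1 ->
  sym_integral l
    ((rVpoly (\row_(k < M.+1) best_coef l M N P k) - P) * 'X^j) = 0.
Proof.
move=> le_MN le_jM size_P.
pose mu k := sym_integral l 'X^(k + j).
have mulP : sym_integral l (P * 'X^j) = \sum_(0 <= i < N.+1) P`_i * mu i.
  rewrite -[P in LHS]coefK poly_def size_P mulr_suml linear_sum big_mkord.
  by apply: eq_bigr => k _; rewrite -scalerAl linearZ /= -exprD.
rewrite mulrBl linearB/= mulP.
rewrite [rVpoly _]poly_def mulr_suml linear_sum/=.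
rewrite (eq_bigr (fun k : 'I_M.+1 => best_coef l M N P k * mu k)); last first.
  by move=> k _; rewrite valK mxE -scalerAl linearZ /= -exprD.
rewrite -(big_mkord predT (fun k => best_coef l M N P k * mu k)).
(* below degree M.+1 the coefficients of P cancel; above, proj_coef_moment
   applies monomial by monomial *)
rewrite [X in _ - X](big_cat_nat (n := M.+1))//=.
under eq_bigr do rewrite /best_coef mulrDl mulr_suml.
rewrite big_split/= exchange_big/= opprD addrACA subrr add0r.
apply/eqP; rewrite subr_eq0; apply/eqP; rewrite !big_nat.
apply: eq_bigr => i /andP[lt_Mi _].
rewrite -[in RHS]/(mu i) /mu -(proj_coef_moment l lt_Mi le_jM) mulr_sumr.
by apply: eq_bigr => k _; rewrite mulrCA mulrA.
Qed.

Lemma best_coefE (R : realType) (l : R) (M N m : nat) (P : {poly R})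
    (e : bool) : (e <= M)%N -> (M <= N)%N ->
  best_coef l M N P (2 * m + e) =
  P`_(2 * m + e) +
  \sum_(((M - e)./2).+1 <= n < ((N - e)./2).+1)
    v_coef l e (M - e)./2 m n * P`_(2 * n + e).
Proof.
move=> le_eM le_MN; rewrite /best_coef; congr (_ + _).
have odd_k k : odd (2 * k + e) = e by case: e {le_eM}; lia.
have half_k k : (2 * k + e)./2 = k by lia.
rewrite (eq_bigr (fun i => if odd i == e then
  v_coef l e (M - e)./2 m i./2 * P`_i else 0)); last first.
  move=> i _; rewrite /proj_coef odd_k half_k eq_sym.
  by case: eqP => //; rewrite mul0r.
rewrite -big_mkcond sum_parity//.
have -> : uphalf (M.+1 - e) = ((M - e)./2).+1 by lia.
have -> : uphalf (N.+1 - e) = ((N - e)./2).+1 by lia.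
by apply: eq_bigr => n _; rewrite half_k.
Qed.

(* For M = 0, floor((M - 1) / 2) = -1, so no m satisfies 0 <= m <= p1;
   the hypothesis (0 < M)%N in the odd part accounts for this case,
   where the truncated (M.-1)./2 would be 0. *)
Theorem mainTheorem2 (R : realType) (l : R) (M N : nat) (P : {poly R})
    (l_gt0 : 0 < l) (ltMN : (M < N)%N) (degP : size P = N.+1) :
  let p := M./2 in
  let p1 := M.-1./2 in
  let q := N./2 in
  let q1 := N.-1./2 in
  exists b : 'rV[R]_M.+1,
    [/\ unique (@is_minimizer R l M P) b,
        (forall m : nat, (m <= p)%N ->
           b 0 (inord (2 * m)) =
           P`_(2 * m) +
           \sum_(p.+1 <= n < q.+1) v_even l p m n * P`_(2 * n))
      & (forall m : nat, (0 < M)%N -> (m <= p1)%N ->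
           b 0 (inord (2 * m + 1)) =
           P`_(2 * m + 1) +
           \sum_(p1.+1 <= n < q1.+1) v_odd l p1 m n * P`_(2 * n + 1))].
Proof.
have le_MN := ltnW ltMN.
move=> p p1 q q1; exists (\row_k best_coef l M N P k); split.
- apply: minimizer_orthogonal => // j le_jM.
  exact: best_coef_orthogonal.
- move=> m le_mp; rewrite mxE inordK; last by rewrite /p in le_mp; lia.
  have := @best_coefE R l M N m P false (leq0n M) le_MN.
  rewrite !subn0 addn0 => ->.
  by under eq_bigr do rewrite addn0.
- move=> m M_gt0 le_mp; rewrite mxE inordK; last by rewrite /p1 in le_mp; lia.
  by have := @best_coefE R l M N m P true M_gt0 le_MN; rewrite !subn1.
Qed.
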